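(* Let $n$ and $s$ be nonnegative integers with $s\le n$. Then, as an identity of rational functions in the indeterminates $q$ and $x$, $$\left(\sum_{k=s}^{n}\frac{(q^{-2n};q^2)_k\,(x;q)_k\,q^k}{(q;q)_{k-s}(q;q)_{k+s}}\right)\left(\sum_{k=s}^{n}\frac{(q^{-2n};q^2)_k\,(q/x;q)_k\,q^k}{(q;q)_{k-s}(q;q)_{k+s}}\right)$$ $$=\frac{(-1)^n(q^2;q^2)_n^2\,q^{-n^2}}{(q^2;q^2)_{n-s}(q^2;q^2)_{n+s}}\sum_{k=s}^{n}\frac{(-1)^k(q^2;q^2)_{n+k}\,(x;q)_k\,(q/x;q)_k\,q^{k^2-2nk}}{(q^2;q^2)_{n-k}\,(q;q)_{k-s}\,(q;q)_{k+s}\,(q;q)_{2k}}.$$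
   Context: For an indeterminate $q$ and an integer $n\ge 0$: $(a;q)_0=1$ and $(a;q)_n=(1-a)(1-aq)\cdots(1-aq^{n-1})$. *)

(* Defs.v *)
(* Rational functions in two indeterminates q, x are modelled
   as the iterated fraction field Q(q)(x) = Frac(Frac(Q[q])[x]). *)
From HB Require Import structures.
From mathcomp Require Import all_boot all_order all_algebra.
Set Implicit Arguments. Unset Strict Implicit. Unset Printing Implicit Defensive.
Import Order.TTheory GRing.Theory Num.Theory.
Local Open Scope ring_scope.

Definition qpoch (R : nzRingType) (a q : R) (n : nat) : R :=
  \prod_(i < n) (1 - a * q ^+ i).

Definition Kq : fieldType := {fraction {poly rat}}.
Definition Kqx : fieldType := {fraction {poly Kq}}.

Definition qv : Kqx := tofrac (polyC (tofrac ('X : {poly rat}) : Kq)).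
Definition xv : Kqx := tofrac ('X : {poly Kq}).

(* Main.v *)
(* Writing k = s + j, m = n - s, X = x q^s, d = q^(2s+1) and b = q^(-2m), the two
   sums on the left become, up to explicit factors, phi(X) and phi(d/X), where
     phi(X) = sum_j (b;q^2)_j (X)_j q^j / ((q)_j (d)_j),
   and the claim reads phi(X) phi(d/X) = phi(d) U(X) with
     U(X) = sum_j (b;q^2)_j (d^2/b;q^2)_j (X)_j (d/X)_j q^j
                  / ((q)_j (d)_j (d)_{2j}).
   Both sides are Laurent polynomials in X, so it is enough to prove this at
   X = 1/p for all p = q^N.  There a three-term q-difference equation for phi
   closes up, for the products u = phi(1/p) phi(dp), V = phi(1/p) phi(dpq) and
   W = phi(1/(pq)) phi(dp), into a linear recursion in N.  V and W also have
   expansions with explicit coefficients, and these, together with U, satisfy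
   the same recursion. *)
Require Import Defs.
From HB Require Import structures.
From mathcomp Require Import all_boot all_order all_algebra.
From mathcomp Require Import ring zify.
Import Order.TTheory GRing.Theory Num.Theory.
Local Open Scope ring_scope.

(** * Elementary rules for q-shifted factorials *)

Lemma qpoch0 (R : nzRingType) (a q : R) : qpoch a q 0 = 1.
Proof. by rewrite /qpoch big_ord0. Qed.

Lemma qpochS (R : nzRingType) (a q : R) n :
  qpoch a q n.+1 = qpoch a q n * (1 - a * q ^+ n).
Proof. by rewrite /qpoch big_ord_recr. Qed.

Lemma qpochD (R : nzRingType) (a q : R) m n :
  qpoch a q (m + n) = qpoch a q m * qpoch (a * q ^+ m) q n.
Proof.
rewrite /qpoch big_split_ord /=; congr (_ * _); apply: eq_bigr => i _.
by rewrite exprD mulrA.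
Qed.

Lemma qpochSl (R : nzRingType) (a q : R) n :
  qpoch a q n.+1 = (1 - a) * qpoch (a * q) q n.
Proof. by rewrite -add1n qpochD qpochS qpoch0 mul1r expr0 mulr1 expr1. Qed.

Lemma qpoch_neq0 (K : fieldType) (a q : K) n :
  (forall i, (i < n)%N -> 1 - a * q ^+ i != 0) -> qpoch a q n != 0.
Proof. by move=> ne0; apply/prodf_neq0 => i _; apply: ne0. Qed.

(** * The series [phi], [U] and the two auxiliary series *)

Definition phi_coef {K : fieldType} (q d b : K) k :=
  qpoch b (q ^+ 2) k * q ^+ k / (qpoch q q k * qpoch d q k).

Definition phi {K : fieldType} (q d b : K) M x :=
  \sum_(k < M) phi_coef q d b k * qpoch x q k.

Definition prod_coef {K : fieldType} (q d b : K) k :=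
  qpoch b (q ^+ 2) k * qpoch (d ^+ 2 / b) (q ^+ 2) k * q ^+ k
  / (qpoch q q k * qpoch d q k * qpoch d q (2 * k)).

(* U(1/p) *)
Definition prod_sum {K : fieldType} (q d b : K) M p :=
  \sum_(k < M) prod_coef q d b k * (qpoch p^-1 q k * qpoch (d * p) q k).

(* [(b - d) / b * adj_sum] and [(b - d) * adj_sum'] are, up to the factor phi(d),
   the products V and W at p. *)
Definition adj_sum {K : fieldType} (q d b : K) M p :=
  \sum_(k < M) prod_coef q d b k / (1 - d * q ^+ (2 * k))
    * (qpoch p^-1 q k * qpoch (d * p * q) q k).

Definition adj_sum' {K : fieldType} (q d b : K) M p :=
  \sum_(k < M) prod_coef q d b k / (1 - d * q ^+ (2 * k)) * q ^+ k
    * (qpoch p^-1 q k * qpoch (d * p * q) q k).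

Lemma poly_eq0_inj (K : idomainType) (P : {poly K}) (f : nat -> K) :
  injective f -> (forall n, root P (f n)) -> P = 0.
Proof.
move=> injf rootf; apply/eqP/negPn/negP => P0.
have : (size (mkseq f (size P)) < size P)%N.
  apply: max_poly_roots => //; last exact: mkseq_uniq.
  by apply/allP => y /mapP[i _ ->].
by rewrite size_mkseq ltnn.
Qed.

(** * The product formula for a terminating [phi] *)

Section ProductFormula.
Context (K : fieldType) (q d b : K) (m : nat).
Hypothesis q0 : q != 0.
Hypothesis b0 : b != 0.
Hypothesis hq : forall n, 1 - q * q ^+ n != 0.
Hypothesis hd : forall n, 1 - d * q ^+ n != 0.

(** By [hq] no positive power of [q] equals 1. This supplies the infinitely many evaluation points
    of [phi_prod]. *)
Lemma expr_inj : injective (fun n => q ^+ n).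
Proof.
suff le i j : (i <= j)%N -> q ^+ i = q ^+ j -> i = j.
  move=> i j e; case/orP: (leq_total i j) => h; first exact: le.
  by apply/esym/le.
move=> /subnK <-; case: (j - i)%N => // k; rewrite exprD => e.
have := hq k; rewrite -exprS => /eqP[]; apply: (mulIf (expf_neq0 i q0)).
by rewrite mulrBl mul1r -e subrr mul0r.
Qed.

Hypothesis hb : qpoch b (q ^+ 2) m.+1 = 0.

Lemma phi_coef0 : phi_coef q d b 0 = 1.
Proof. by rewrite /phi_coef !qpoch0 expr0 !mulr1 divr1. Qed.

Lemma phi_coefS k : phi_coef q d b k.+1 =
  phi_coef q d b k * q * (1 - b * (q ^+ k) ^+ 2)
    / ((1 - q * q ^+ k) * (1 - d * q ^+ k)).
Proof.
have h1 : qpoch q q k != 0 by apply: qpoch_neq0.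
have h2 : qpoch d q k != 0 by apply: qpoch_neq0.
have := hq k; have := hd k.
rewrite /phi_coef !qpochS (exprS q k) (exprAC q 2 k).
move: (qpoch q q k) (qpoch d q k) (q ^+ k) h1 h2 => x y z *.
by field; do ?[apply/andP; split]; rewrite ?oner_neq0.
Qed.

(* Truncated sums satisfy the q-difference equation of phi up to a boundary term,
   which contains the coefficient of index M + 1 and so vanishes when b = q^(-2M). *)
Lemma phi_rec_partial M x :
  (x - d) * phi q d b M.+1 (x / q) - (b - d) * phi q d b M.+1 x
    - b * (x - 1) * phi q d b M.+1 (x * q)
  = x / q * (q ^- M - d) * phi_coef q d b M.+1 * (1 - q * q ^+ M)
      * qpoch x q M.
Proof.
elim: M => [|M E].
  rewrite /phi !big_ord1 phi_coefS phi_coef0 !qpoch0 expr0.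
  have := hq 0; have := hd 0; rewrite expr0 !mulr1 => *.
  by field; do ?[apply/andP; split]; rewrite ?oner_neq0.
rewrite {1}/phi big_ord_recr -/(phi q d b M.+1 (x / q)) /=.
rewrite {2}/phi big_ord_recr -/(phi q d b M.+1 x) /=.
rewrite {3}/phi big_ord_recr -/(phi q d b M.+1 (x * q)) /=.
(* Shifting the argument by a factor [q] changes only end factors, so each new term is a multiple of
   [qpoch x q M] and a rational identity remains. *)
have e1 : qpoch (x / q) q M.+1 = (1 - x / q) * qpoch x q M.
  by rewrite qpochSl divfK.
have e2 : (x - 1) * qpoch (x * q) q M.+1 = - qpoch x q M.+2.
  by rewrite [in RHS]qpochSl -mulNr opprB.
move: (phi q d b M.+1 (x / q)) (phi q d b M.+1 x) (phi q d b M.+1 (x * q)) E.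
move=> u v w E; rewrite e1; set c := phi_coef q d b M.+1 in E *.
rewrite [LHS](_ : _ = (x - d) * u - (b - d) * v - b * (x - 1) * w
  + c * ((x - d) * ((1 - x / q) * qpoch x q M) - (b - d) * qpoch x q M.+1
         - b * ((x - 1) * qpoch (x * q) q M.+1))); last by ring.
rewrite {}E {}e2 (phi_coefS M.+1) -/c !qpochS !exprS.
have := hq M.+1; have := hd M.+1; rewrite !exprS.
have hM : q ^+ M != 0 by rewrite expf_neq0.
move: c (qpoch x q M) (q ^+ M) hM => {u v w e1} c P Q *.
by field; do ?[apply/andP; split].
Qed.

(** * Recursions for the explicit expansions *)

Lemma prod_coef0 : prod_coef q d b 0 = 1.
Proof. by rewrite /prod_coef !qpoch0 expr0 !mulr1 divr1. Qed.

Lemma prod_coefS k : prod_coef q d b k.+1 =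
  prod_coef q d b k * q
    * (1 - b * (q ^+ k) ^+ 2) * (1 - d ^+ 2 / b * (q ^+ k) ^+ 2)
    / ((1 - q * q ^+ k) * (1 - d * q ^+ k)
       * (1 - d * q ^+ (2 * k)) * (1 - d * q ^+ (2 * k).+1)).
Proof.
have h1 : qpoch q q k != 0 by apply: qpoch_neq0.
have h2 : qpoch d q k != 0 by apply: qpoch_neq0.
have h3 : qpoch d q (2 * k) != 0 by apply: qpoch_neq0.
have := hq k; have := hd k; have := hd (2 * k)%N; have := hd (2 * k).+1.
rewrite /prod_coef (_ : (2 * k.+1 = (2 * k).+2)%N); last by lia.
rewrite !qpochS (exprS q k) (exprAC q 2 k).
move: (qpoch q q k) (qpoch d q k) (qpoch d q (2 * k)) h1 h2 h3 => x y z *.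
by field; do ?[apply/andP; split].
Qed.

(** The prefactor is absorbed as the missing first factor of a factorial, here and in
    [adj_term_shiftE]. This brings all the series to the common basis
    [qpoch p^-1 q k * qpoch (d * p) q k], where they can be compared term by term. *)
Lemma adj_termE p k :
  (1 - d * p) * (qpoch p^-1 q k * qpoch (d * p * q) q k)
  = qpoch p^-1 q k * qpoch (d * p) q k * (1 - d * p * q ^+ k).
Proof. by rewrite mulrCA -qpochSl qpochS mulrA. Qed.

Lemma adj_term_shiftE p k : p != 0 ->
  (1 - p) * (qpoch (p / q)^-1 q k * qpoch (d * (p / q) * q) q k)
  = qpoch p^-1 q k * qpoch (d * p) q k * (q ^+ k - p).
Proof.
move=> p0.
rewrite (_ : (p / q)^-1 = p^-1 * q); last by field; apply/andP.
rewrite (_ : d * (p / q) * q = d * p); last by field.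
rewrite (_ : 1 - p = - p * (1 - p^-1)); last by field.
rewrite -mulrA [X in _ * X]mulrA -qpochSl qpochS.
by field.
Qed.

(** With Q = q^k, the coefficients agree because 1 - dpQ = (1 - dQ^2) + dQ(Q - p). *)
Lemma adj_rel M p : p != 0 ->
  (1 - d * p) * adj_sum q d b M p
  = prod_sum q d b M p + d * ((1 - p) * adj_sum' q d b M (p / q)).
Proof.
move=> p0; rewrite /adj_sum /adj_sum' /prod_sum !mulr_sumr -big_split.
apply: eq_bigr => k _ /=.
rewrite (mulrCA (1 - d * p)) adj_termE (mulrCA (1 - p)) adj_term_shiftE //.
have := hd (2 * k); rewrite mulnC exprM => h.
by field.
Qed.

(** As for [adj_rel], now from Q(1 - dpQ) = p(1 - dQ^2) + (Q - p). *)
Lemma adj_rel' M p : p != 0 ->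
  (1 - d * p) * adj_sum' q d b M p
  = p * prod_sum q d b M p + (1 - p) * adj_sum q d b M (p / q).
Proof.
move=> p0; rewrite /adj_sum /adj_sum' /prod_sum !mulr_sumr -big_split.
apply: eq_bigr => k _ /=.
rewrite (mulrCA (1 - d * p)) adj_termE (mulrCA (1 - p)) adj_term_shiftE //.
have := hd (2 * k); rewrite mulnC exprM => h.
by field.
Qed.

(** Unlike the two relations above, this one does not hold term by term: the sum telescopes. The
    right side is the boundary term, which vanishes once the coefficient of index [M.+1] does. *)
Lemma prod_sum_rec_partial M p : p != 0 ->
  (1 - d * p) ^+ 2 * prod_sum q d b M.+1 (q * p)
    - d * (1 - p) ^+ 2 * prod_sum q d b M.+1 (p / q)
    - (b - d) ^+ 2 / b * (p * ((1 - d * p) * adj_sum q d b M.+1 p)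
                          + (1 - p) * adj_sum q d b M.+1 (p / q))
  = (1 - d * p ^+ 2) * (1 - d * q ^+ M) * (1 - d * q ^+ (2 * M).+1)
      * (1 - q * q ^+ M) / (q * q ^+ M) * prod_coef q d b M.+1
      * (qpoch p^-1 q M * qpoch (d * p) q M).
Proof.
move=> p0; elim: M => [|M IH].
  rewrite /prod_sum /adj_sum !big_ord1 prod_coefS prod_coef0 !qpoch0 !expr0.
  have := hq 0; have := hd 0; have := hd 1; rewrite expr0 expr1 !mulr1 => *.
  by field; do ?[apply/andP; split]; rewrite ?oner_neq0.
rewrite /prod_sum /adj_sum 4!(big_ord_recr M.+1) /= -/(prod_sum q d b M.+1 (q * p))
  -/(prod_sum q d b M.+1 (p / q)) -/(adj_sum q d b M.+1 p)
  -/(adj_sum q d b M.+1 (p / q)).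
(* One factor [1 - d * p] here, and one factor [1 - p] in [e2], complete the shifted factorials, so
   that both new terms become multiples of [qpoch p^-1 q M * qpoch (d * p) q M]. *)
have e1 : (1 - d * p) * (qpoch (q * p)^-1 q M.+1 * qpoch (d * (q * p)) q M.+1)
   = (1 - (q * p)^-1) * (1 - d * p * q ^+ M) * (1 - d * p * (q * q ^+ M))
      * (qpoch p^-1 q M * qpoch (d * p) q M).
  rewrite qpochSl (_ : (q * p)^-1 * q = p^-1); last by field; apply/andP.
  by rewrite (_ : d * (q * p) = d * p * q) 1?mulrCA -?qpochSl ?qpochS ?exprS; ring.
have e2 : (1 - p) * (qpoch (p / q)^-1 q M.+1 * qpoch (d * (p / q)) q M.+1)
   = - p * (1 - d * p / q) * (1 - q ^+ M / p) * (1 - q * q ^+ M / p)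
      * (qpoch p^-1 q M * qpoch (d * p) q M).
  rewrite (_ : (p / q)^-1 = p^-1 * q); last by field; apply/andP.
  rewrite (_ : 1 - p = - p * (1 - p^-1)); last by field.
  have -> : qpoch (d * (p / q)) q M.+1 = (1 - d * (p / q)) * qpoch (d * p) q M.
    by rewrite qpochSl (_ : d * (p / q) * q = d * p) //; field.
  rewrite -mulrA [X in _ * X]mulrA -qpochSl !qpochS exprS.
  by field; apply/andP.
move: (prod_sum q d b M.+1 (q * p)) (prod_sum q d b M.+1 (p / q)) IH => u v.
move: (adj_sum q d b M.+1 p) (adj_sum q d b M.+1 (p / q)) => a a' E.
set c := prod_coef q d b M.+1 in E *.
set r := 1 - d * q ^+ (2 * M.+1).
rewrite [LHS](_ : _ = (1 - d * p) ^+ 2 * u - d * (1 - p) ^+ 2 * v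
  - (b - d) ^+ 2 / b * (p * ((1 - d * p) * a) + (1 - p) * a')
  + c * ((1 - d * p) * ((1 - d * p)
           * (qpoch (q * p)^-1 q M.+1 * qpoch (d * (q * p)) q M.+1))
         - d * (1 - p) * ((1 - p)
           * (qpoch (p / q)^-1 q M.+1 * qpoch (d * (p / q)) q M.+1))
         - (b - d) ^+ 2 / b / r
           * (p * ((1 - d * p)
                * (qpoch p^-1 q M.+1 * qpoch (d * p * q) q M.+1))
              + (1 - p) * (qpoch (p / q)^-1 q M.+1
                * qpoch (d * (p / q) * q) q M.+1)))); last by ring.
rewrite {}E {}e1 {}e2 adj_termE adj_term_shiftE // prod_coefS -/c /r !qpochS.
have := hq M; have := hq M.+1; have := hd M; have := hd M.+1.
have := hd (2 * M).+1; have := hd (2 * M.+1); have := hd (2 * M.+1).+1.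
rewrite (_ : (2 * M.+1 = (2 * M).+2)%N); last by lia.
rewrite !exprS (mulnC 2) exprM.
have hM : q ^+ M != 0 by rewrite expf_neq0.
move: c (qpoch p^-1 q M) (qpoch (d * p) q M) (q ^+ M) hM.
move=> {u v a a' r} c P P' Q *.
by field; do ?[apply/andP; split].
Qed.

(** * Termination removes the boundary terms *)

Lemma phi_coef_end : phi_coef q d b m.+1 = 0.
Proof. by rewrite /phi_coef hb !mul0r. Qed.

Lemma prod_coef_end : prod_coef q d b m.+1 = 0.
Proof. by rewrite /prod_coef hb !mul0r. Qed.

Lemma phi_rec x : (x - d) * phi q d b m.+1 (x / q)
  = (b - d) * phi q d b m.+1 x + b * (x - 1) * phi q d b m.+1 (x * q).
Proof.
apply/eqP; rewrite -subr_eq0 opprD addrA phi_rec_partial.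
by rewrite phi_coef_end !(mul0r, mulr0).
Qed.

Lemma prod_sum_rec p : p != 0 ->
  (1 - d * p) ^+ 2 * prod_sum q d b m.+1 (q * p)
  = (b - d) ^+ 2 / b * (p * ((1 - d * p) * adj_sum q d b m.+1 p)
                          + (1 - p) * adj_sum q d b m.+1 (p / q))
    + d * (1 - p) ^+ 2 * prod_sum q d b m.+1 (p / q).
Proof.
move=> p0; apply/eqP; rewrite -subr_eq0 opprD addrCA addrA [X in X - _]addrC.
rewrite addrAC prod_sum_rec_partial //.
by rewrite prod_coef_end !(mul0r, mulr0).
Qed.

(** [phi_rec] gives [f] and [g] at [q * p] from their values at [p] and [p / q]; [adj_rel],
    [adj_rel'] and [prod_sum_rec] are the matching recursions for [V], [W] and [U]. The factor
    [1 - p] makes the last three hypotheses trivial at [p = 1], so the induction can start there. *)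
Lemma phi_prod_pow_step (p : K)
    (f := fun p : K => phi q d b m.+1 p^-1) (g := fun p => phi q d b m.+1 (d * p))
    (U := prod_sum q d b m.+1)
    (V := fun p : K => (b - d) / b * adj_sum q d b m.+1 p)
    (W := fun p : K => (b - d) * adj_sum' q d b m.+1 p) (c := g 1) :
  p != 0 -> 1 - d * p != 0 ->
  f p * g p = c * U p ->
  (1 - p) * (f (p / q) * g p) = (1 - p) * (c * V (p / q)) ->
  (1 - p) * (f p * g (p / q)) = (1 - p) * (c * W (p / q)) ->
  (1 - p) * (f (p / q) * g (p / q)) = (1 - p) * (c * U (p / q)) ->
  [/\ f (q * p) * g (q * p) = c * U (q * p),
      f p * g (q * p) = c * V p & f (q * p) * g p = c * W p].
Proof.
move=> p0 hp hu hv hw hu'.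
(* At [x = p^-1] the equation moves [f] forward through [x / q]; at [x = d * p], used for [rg], it
   moves [g] forward through [x * q]. *)
have rf : (1 - d * p) * f (q * p)
    = (b - d) * p * f p + b * ((1 - p) * f (p / q)).
  have := phi_rec p^-1.
  rewrite (_ : p^-1 / q = (q * p)^-1); last by field; apply/andP.
  rewrite (_ : p^-1 * q = (p / q)^-1); last by field; apply/andP.
  rewrite -/(f (q * p)) -/(f (p / q)) -/(f p) => /(congr1 ( *%R p)) E.
  rewrite [LHS](_ : _ = p * ((p^-1 - d) * f (q * p)));
    last by field.
  by rewrite E; field.
have rg : b * ((1 - d * p) * g (q * p))
    = (b - d) * g p + d * ((1 - p) * g (p / q)).
  have := phi_rec (d * p).
  rewrite (_ : d * p / q = d * (p / q)); last by rewrite mulrA.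
  rewrite (_ : d * p * q = d * (q * p)); last by ring.
  rewrite -/(g (q * p)) -/(g (p / q)) -/(g p) => E.
  rewrite [LHS](_ : _ = - (b * (d * p - 1) * g (q * p))); last by ring.
  have -> : b * (d * p - 1) * g (q * p)
    = (d * p - d) * g (p / q) - (b - d) * g p.
    by rewrite E [RHS]addrC addKr.
  ring.
have ra : (1 - d * p) * adj_sum q d b m.+1 p = _ := adj_rel m.+1 p p0.
have ra' : (1 - d * p) * adj_sum' q d b m.+1 p = _ := adj_rel' m.+1 p p0.
have ru := prod_sum_rec p p0.
rewrite /U /V /W in hu hv hw hu' *.
(* This product comes first because expanding [f (q * p) * g (q * p)] produces it. *)
have hV : f p * g (q * p) = c * ((b - d) / b * adj_sum q d b m.+1 p).
  apply: (mulfI (mulf_neq0 b0 hp)).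
  rewrite [LHS](_ : _ = f p * (b * ((1 - d * p) * g (q * p)))); last by ring.
  rewrite [RHS](_ : _ = c * (b - d) * ((1 - d * p) * adj_sum q d b m.+1 p));
    last by field.
  rewrite ra rg mulrDr (mulrCA (f p)) hu (mulrCA (f p) d) (mulrCA (f p)) hw.
  ring.
split=> //.
  apply: (mulfI (mulf_neq0 b0 (expf_neq0 2 hp))).
  rewrite [LHS](_ : _ = (1 - d * p) * f (q * p)
     * (b * ((1 - d * p) * g (q * p)))); last by ring.
  rewrite rf.
  rewrite [LHS](_ : _ = (b - d) * p * b * (1 - d * p) * (f p * g (q * p))
    + b * (((1 - p) * f (p / q)) * (b * ((1 - d * p) * g (q * p)))));
    last by ring.
  rewrite hV rg.
  rewrite [LHS](_ : _ = (b - d) * p * b * (1 - d * p)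
     * (c * ((b - d) / b * adj_sum q d b m.+1 p))
    + b * ((b - d) * ((1 - p) * (f (p / q) * g p))
           + d * (1 - p) * ((1 - p) * (f (p / q) * g (p / q)))));
    last by ring.
  rewrite hv hu'.
  rewrite [RHS](_ : _ = b * c * ((1 - d * p) ^+ 2
     * prod_sum q d b m.+1 (q * p))); last by ring.
  by rewrite ru; field.
apply: (mulfI hp); rewrite mulrA rf.
rewrite [LHS](_ : _ = (b - d) * p * (f p * g p)
    + b * ((1 - p) * (f (p / q) * g p))); last by ring.
rewrite hu hv.
rewrite [RHS](_ : _ = c * (b - d)
   * ((1 - d * p) * adj_sum' q d b m.+1 p)); last by ring.
by rewrite ra'; field.
Qed.

Lemma phi_prod_pow N (p := q ^+ N) :
  phi q d b m.+1 p^-1 * phi q d b m.+1 (d * p)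
  = phi q d b m.+1 d * prod_sum q d b m.+1 p.
Proof.
pose f (p : K) := phi q d b m.+1 p^-1; pose g (p : K) := phi q d b m.+1 (d * p).
pose U := prod_sum q d b m.+1.
pose V (p : K) := (b - d) / b * adj_sum q d b m.+1 p.
pose W (p : K) := (b - d) * adj_sum' q d b m.+1 p.
have hqn n : q ^+ n != 0 by rewrite expf_neq0.
rewrite -[X in phi _ _ _ _ X * prod_sum _ _ _ _ _](mulr1 d).
rewrite -/(f p) -/(g p) -/(g 1) -/(U p) {}/p.
(* The invariant spans two consecutive powers: the step at [q ^+ N.+1] consumes [U], [V] and [W] at
   [q ^+ N]. *)
suff: f (q ^+ N) * g (q ^+ N) = g 1 * U (q ^+ N)
  /\ [/\ f (q * q ^+ N) * g (q * q ^+ N) = g 1 * U (q * q ^+ N),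
      f (q ^+ N) * g (q * q ^+ N) = g 1 * V (q ^+ N)
      & f (q * q ^+ N) * g (q ^+ N) = g 1 * W (q ^+ N)] by case.
elim: N => [|N [IH1 [IH2 IH3 IH4]]].
  (* Since [qpoch 1 q k] vanishes for k > 0, only the constant terms of [f 1] and [U 1] survive. *)
  have e : f 1 * g 1 = g 1 * U 1.
    rewrite mulrC /f /U /phi /prod_sum !big_ord_recl !big1 => [|i _|i _].
    - by rewrite phi_coef0 prod_coef0 !qpoch0 !mulr1.
    - by rewrite qpochSl invr1 subrr !mul0r mulr0.
    - by rewrite qpochSl invr1 subrr !mul0r mulr0.
  have h1 := hd 0; rewrite expr0 in h1 *; split=> //.
  by apply: phi_prod_pow_step; rewrite ?oner_neq0 // subrr !mul0r.
rewrite exprS; split=> //.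
have e : q * q ^+ N / q = q ^+ N by rewrite mulrAC mulfV // mul1r.
apply: phi_prod_pow_step; rewrite ?e -?exprS //; rewrite ?exprS.
- exact: IH2.
- by congr (_ * _); exact: IH3.
- by congr (_ * _); exact: IH4.
- by congr (_ * _); exact: IH1.
Qed.

Lemma phi_prod x : x != 0 ->
  phi q d b m.+1 x * phi q d b m.+1 (d / x)
  = phi q d b m.+1 d * prod_sum q d b m.+1 x^-1.
Proof.
(* [rev k] is X^m (d/X;q)_k, a polynomial because k <= m. Multiplying by X^m thus turns the claim
   into a polynomial identity, which [phi_prod_pow] verifies at all points q^(-N). *)
pose rev k : {poly K} := 'X^(m - k) * \prod_(i < k) ('X - (d * q ^+ i)%:P).
pose qp k : {poly K} := qpoch 'X q%:P k.
have revE k y : y != 0 -> (k <= m)%N -> (rev k).[y] = y ^+ m * qpoch (d / y) q k.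
  move=> y0 lekm; rewrite /rev hornerM hornerXn horner_prod.
  rewrite -[in RHS](subnK lekm) exprD -mulrA; congr (_ * _).
  have -> : y ^+ k = \prod_(i < k) y by rewrite prodr_const card_ord.
  rewrite /qpoch -big_split; apply: eq_bigr => i _.
  by rewrite /= !hornerE; field.
have qpE k y : (qp k).[y] = qpoch y q k.
  by rewrite horner_prod; apply: eq_bigr => i _; rewrite !hornerE.
pose P1 : {poly K} := \sum_(k < m.+1) phi_coef q d b k *: qp k.
pose P2 : {poly K} := \sum_(k < m.+1) phi_coef q d b k *: rev k.
pose P3 : {poly K} := \sum_(k < m.+1) prod_coef q d b k *: (qp k * rev k).
have P1E y : P1.[y] = phi q d b m.+1 y.
  by rewrite horner_sum; apply: eq_bigr => k _; rewrite hornerZ qpE.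
have P2E y : y != 0 -> P2.[y] = y ^+ m * phi q d b m.+1 (d / y).
  move=> y0; rewrite horner_sum mulr_sumr; apply: eq_bigr => k _.
  by rewrite hornerZ revE ?leq_ord // mulrCA.
have P3E y : y != 0 -> P3.[y] = y ^+ m * prod_sum q d b m.+1 y^-1.
  move=> y0; rewrite horner_sum mulr_sumr; apply: eq_bigr => k _.
  by rewrite hornerZ hornerM qpE revE ?leq_ord // invrK; ring.
have eqP : P1 * P2 - phi q d b m.+1 d *: P3 = 0.
  apply: (@poly_eq0_inj _ _ (fun n => (q ^+ n)^-1)) => [i j /invr_inj|n].
    exact: expr_inj.
  have hqn : (q ^+ n)^-1 != 0 by rewrite invr_eq0 expf_neq0.
  rewrite /root !hornerE P1E P2E // P3E // invrK mulrCA phi_prod_pow.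
  by rewrite mulrCA subrr.
move=> x0; apply: (mulfI (expf_neq0 m x0)).
move/(congr1 (horner^~ x)): eqP; rewrite !hornerE P1E P2E // P3E // => /eqP.
by rewrite subr_eq0 => /eqP e; rewrite /= -!mulrA mulrCA e mulrCA.
Qed.

End ProductFormula.

(** * The case b = q^(-2m), and the return to the original sums *)

Section BaseQ.
Context (K : fieldType) (q : K).
Hypothesis q0 : q != 0.
Hypothesis hq : forall n, 1 - q * q ^+ n != 0.

Lemma qpoch_neg_pow_end m : qpoch (q ^- (2 * m)) (q ^+ 2) m.+1 = 0.
Proof. by rewrite qpochS -exprM mulVf ?expf_neq0 // subrr mulr0. Qed.

(** Factor by factor, 1 - q^(-2i) = -q^(-2i) (1 - q^(2i)). The form without division keeps the
    induction simple; it is solved for the factorial of negative base where it is used. *)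
Lemma qpoch_neg_pow m j : (j <= m)%N ->
  qpoch (q ^+ 2) (q ^+ 2) (m - j) * qpoch (q ^- (2 * m)) (q ^+ 2) j
    * q ^+ j * q ^+ (2 * m * j)
  = (-1) ^+ j * q ^+ (j * j) * qpoch (q ^+ 2) (q ^+ 2) m.
Proof.
elim: j => [|j IH] ltjm; first by rewrite subn0 muln0 !expr0 qpoch0; ring.
have := IH (ltnW ltjm); rewrite -{1}(subnSK ltjm) !qpochS => E.
rewrite (exprS q j) (exprS (-1) j).
have e1 : q ^+ (2 * m * j.+1) = q ^+ (2 * m * j) * q ^+ (2 * m).
  by rewrite -exprD; congr (_ ^+ _); lia.
have e2 : q ^+ (j.+1 * j.+1) = q ^+ (j * j) * (q * q ^+ (2 * j)).
  by rewrite -exprS -exprD; congr (_ ^+ _); lia.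
have e3 : q ^+ (2 * m) = q ^+ 2 * (q ^+ 2) ^+ (m - j.+1) * q ^+ (2 * j).
  by rewrite -exprM -!exprD; congr (_ ^+ _); lia.
have q2m : q ^+ (2 * m) != 0 by rewrite expf_neq0.
rewrite e1 e2 -exprM.
rewrite [RHS](_ : _ = - q * q ^+ (2 * j)
  * ((-1) ^+ j * q ^+ (j * j) * qpoch (q ^+ 2) (q ^+ 2) m)); last by ring.
rewrite -E {E}; move: e3 q2m.
move: (q ^+ (2 * m)) => w.
by move=> -> *; field; rewrite !expf_neq0.
Qed.

(** This is [phi] at [x = d], where [qpoch d q k] cancels. As (b;q^2)_k = (c;q)_k (-c;q)_k with c^2
    = b, it is a truncated 2phi1(c, -c; 0; q, q). *)
Definition qsum b M : K :=
  \sum_(k < M) qpoch b (q ^+ 2) k * q ^+ k / qpoch q q k.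

Lemma qsum_rec_partial b M :
  qsum b M.+1 + b * q * qsum (b * q ^+ 2) M.+1
  = qpoch (b * q ^+ 2) (q ^+ 2) M * (1 + b * q * q ^+ M) / qpoch q q M.
Proof.
elim: M => [|M IH].
  by rewrite /qsum !big_ord1 !qpoch0 expr0; field; rewrite ?oner_neq0.
rewrite /qsum 2!(big_ord_recr M.+1) /= -/(qsum b M.+1) -/(qsum (b * q ^+ 2) M.+1).
rewrite mulrDr addrACA IH [qpoch b _ _]qpochSl !qpochS.
rewrite (exprS q M) (exprAC q 2 M).
have h1 : qpoch q q M != 0 by apply: qpoch_neq0.
have := hq M.
move: (qpoch q q M) h1 => P *.
by field; do ?[apply/andP; split].
Qed.

(** A case of the q-Chu-Vandermonde sum with lower parameter 0. The recursion links the exponents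
    [m.+1] and [m], and its boundary term vanishes. *)
Lemma qsum_pow m : qsum (q ^- (2 * m)) m.+1 = (-1) ^+ m * q ^- (m * m).
Proof.
elim: m => [|m IH].
  by rewrite /qsum big_ord1 !qpoch0 muln0 !expr0; field; rewrite ?oner_neq0.
have := qsum_rec_partial (q ^- (2 * m.+1)) m.+1.
have e : q ^- (2 * m.+1) * q ^+ 2 = q ^- (2 * m).
  rewrite (_ : (2 * m.+1 = 2 * m + 2)%N); last by lia.
  by rewrite exprD invfM mulfVK // expf_neq0.
rewrite e qpoch_neg_pow_end !mul0r => /eqP; rewrite addr_eq0 => /eqP ->.
(* The recursion leaves one term more than the induction hypothesis has; that term is zero. *)
rewrite /qsum big_ord_recr -/(qsum (q ^- (2 * m)) m.+1) /= IH.
rewrite qpoch_neg_pow_end !mul0r addr0 exprS.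
rewrite (_ : (2 * m.+1 = (2 * m).+2)%N); last by lia.
rewrite (_ : (m.+1 * m.+1 = m * m + (2 * m).+1)%N); last by lia.
have h1 : q ^+ (m * m) != 0 by rewrite expf_neq0.
have h2 : q ^+ (2 * m) != 0 by rewrite expf_neq0.
rewrite exprD !exprS; move: (q ^+ (m * m)) (q ^+ (2 * m)) h1 h2 => *.
by field; do ?[apply/andP; split].
Qed.

Lemma phi_self d m : (forall n, 1 - d * q ^+ n != 0) ->
  phi q d (q ^- (2 * m)) m.+1 d = (-1) ^+ m * q ^- (m * m).
Proof.
move=> hd; rewrite -qsum_pow; apply: eq_bigr => k _; rewrite /phi_coef.
have h1 : qpoch q q k != 0 by apply: qpoch_neq0.
have h2 : qpoch d q k != 0 by apply: qpoch_neq0.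
by field; apply/andP.
Qed.

(** Splitting (q;q)_(2s+j) after 2s factors produces d = q^(2s+1); splitting (q^(-2n);q^2)_(s+j)
    after s factors produces b = q^(-2m). *)
Lemma left_sumE m s x (n := (m + s)%N) :
  \sum_(s <= k < n.+1)
     qpoch (q ^- (2 * n)) (q ^+ 2) k * qpoch x q k * q ^+ k
       / (qpoch q q (k - s) * qpoch q q (k + s))
  = qpoch (q ^- (2 * n)) (q ^+ 2) s * qpoch x q s * q ^+ s / qpoch q q (2 * s)
    * phi q (q ^+ (2 * s).+1) (q ^- (2 * m)) m.+1 (x * q ^+ s).
Proof.
rewrite -{1}(add0n s) big_addn -addSn addnK big_mkord /phi mulr_sumr.
apply: eq_bigr => j _; rewrite addnK -addnA addnn -mul2n !(addnC j).
rewrite (qpochD _ _ _ (2 * s)) !(qpochD _ _ _ s j) exprD -exprM -exprS.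
have -> : q ^- (2 * n) * q ^+ (2 * s) = q ^- (2 * m).
  by rewrite /n mulnDr exprD invfM mulfVK // expf_neq0.
rewrite /phi_coef.
have h1 : qpoch q q (2 * s) != 0 by apply: qpoch_neq0.
have h2 : qpoch q q j != 0 by apply: qpoch_neq0.
have h3 : qpoch (q ^+ (2 * s).+1) q j != 0.
  by apply: qpoch_neq0 => i _; rewrite exprS -mulrA -exprD.
by field; do ?[apply/andP; split].
Qed.

(** The factorials split as on the left, and (q;q)_(2k) yields a second (q;q)_(2s) together with
    (d;q)_(2j). *)
Lemma right_sumE m s x (n := (m + s)%N) : x != 0 ->
  \sum_(s <= k < n.+1)
      (-1) ^+ k * qpoch (q ^+ 2) (q ^+ 2) (n + k) * qpoch x q k
        * qpoch (q / x) q k * (q ^+ (k * k) * q ^- (2 * n * k))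
      / (qpoch (q ^+ 2) (q ^+ 2) (n - k) * qpoch q q (k - s)
         * qpoch q q (k + s) * qpoch q q (2 * k))
  = (-1) ^+ s * qpoch (q ^+ 2) (q ^+ 2) (n + s) * qpoch x q s
      * qpoch (q / x) q s * (q ^+ (s * s) * q ^- (2 * n * s))
      / (qpoch (q ^+ 2) (q ^+ 2) m * qpoch q q (2 * s) ^+ 2)
    * prod_sum q (q ^+ (2 * s).+1) (q ^- (2 * m)) m.+1 (x * q ^+ s)^-1.
Proof.
move=> x0.
rewrite -{1}(add0n s) big_addn -addSn addnK big_mkord /prod_sum mulr_sumr.
apply: eq_bigr => j _; rewrite addnK -[(j + s + s)%N]addnA addnn -mul2n.
have := @qpoch_neg_pow m j (ltn_ord j).
rewrite (_ : (2 * (j + s) = 2 * s + 2 * j)%N); last by lia.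
rewrite (_ : (n + (j + s) = n + s + j)%N); last by lia.
rewrite (_ : (n - (j + s) = m - j)%N); last by lia.
rewrite !(addnC j) !(qpochD _ _ _ (2 * s)) (qpochD _ _ _ (n + s)) !(qpochD _ _ _ s j).
rewrite -(exprS q) invrK.
rewrite (_ : q / x * q ^+ s = q ^+ (2 * s).+1 * (x * q ^+ s)^-1); last first.
  rewrite exprS mul2n -addnn exprD; field.
  by rewrite expf_neq0.
rewrite /prod_coef.
(* Since n + s = m + 2s, the factor (d^2/b;q^2)_j is exactly the tail of (q^2;q^2)_(n+k). *)
rewrite (_ : (q ^+ (2 * s).+1) ^+ 2 / q ^- (2 * m) = q ^+ 2 * (q ^+ 2) ^+ (n + s));
  last by rewrite invrK -!exprM -!exprD; congr (_ ^+ _); lia.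
(* The cross terms 2sj of k^2 and of 2nk cancel. *)
have -> : q ^+ ((s + j) * (s + j)) * q ^- (2 * n * (s + j))
   = q ^+ (s * s) * q ^- (2 * n * s) * (q ^+ (j * j) * q ^- (2 * m * j)).
  rewrite (_ : ((s + j) * (s + j) = s * s + j * j + 2 * s * j)%N); last by lia.
  rewrite (_ : (2 * n * (s + j) = 2 * n * s + 2 * m * j + 2 * s * j)%N);
    last by lia.
  rewrite !exprD; field.
  by do ?[apply/andP; split]; rewrite expf_neq0.
have hq2 n' : 1 - q ^+ 2 * (q ^+ 2) ^+ n' != 0.
  by rewrite -exprM -exprD exprS.
have h1 : qpoch q q (2 * s) != 0 by apply: qpoch_neq0.
have h2 : qpoch q q j != 0 by apply: qpoch_neq0.
have hd i : 1 - q ^+ (2 * s).+1 * q ^+ i != 0 by rewrite exprS -mulrA -exprD.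
have h3 : qpoch (q ^+ (2 * s).+1) q j != 0 by apply: qpoch_neq0.
have h4 : qpoch (q ^+ (2 * s).+1) q (2 * j) != 0 by apply: qpoch_neq0.
have h5 : qpoch (q ^+ 2) (q ^+ 2) (m - j) != 0 by apply: qpoch_neq0.
have h6 : qpoch (q ^+ 2) (q ^+ 2) m != 0 by apply: qpoch_neq0.
have h7 : q ^+ (2 * m * j) != 0 by rewrite expf_neq0.
have h8 : q ^+ (2 * n * s) != 0 by rewrite expf_neq0.
(* Rewriting (b;q^2)_j creates the sign, the power q^(j^2) and the denominator (q^2;q^2)_(m-j) of
   the original summand. *)
set B := qpoch (q ^- (2 * m)) _ _; rewrite exprD => E.
have {E} -> : B = (-1) ^+ j * q ^+ (j * j) * qpoch (q ^+ 2) (q ^+ 2) m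
   / (qpoch (q ^+ 2) (q ^+ 2) (m - j) * q ^+ j * q ^+ (2 * m * j)).
  have hj : q ^+ j != 0 by rewrite expf_neq0.
  by rewrite -E; field; do ?[apply/andP; split].
have hj : q ^+ j != 0 by rewrite expf_neq0.
by field; do ?[apply/andP; split].
Qed.

(** Valid in any field for nonzero [x] and nonzero [q] that is not a root of unity. *)
Theorem qpoch_sums_product n s x : (s <= n)%N -> x != 0 ->
  (\sum_(s <= k < n.+1)
     qpoch (q ^- (2 * n)) (q ^+ 2) k * qpoch x q k * q ^+ k
       / (qpoch q q (k - s) * qpoch q q (k + s)))
  * (\sum_(s <= k < n.+1)
     qpoch (q ^- (2 * n)) (q ^+ 2) k * qpoch (q / x) q k * q ^+ k
       / (qpoch q q (k - s) * qpoch q q (k + s)))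
  =
  (-1) ^+ n * (qpoch (q ^+ 2) (q ^+ 2) n) ^+ 2 * q ^- (n * n)
    / (qpoch (q ^+ 2) (q ^+ 2) (n - s) * qpoch (q ^+ 2) (q ^+ 2) (n + s))
  * \sum_(s <= k < n.+1)
      (-1) ^+ k * qpoch (q ^+ 2) (q ^+ 2) (n + k) * qpoch x q k
        * qpoch (q / x) q k * (q ^+ (k * k) * q ^- (2 * n * k))
      / (qpoch (q ^+ 2) (q ^+ 2) (n - k) * qpoch q q (k - s)
         * qpoch q q (k + s) * qpoch q q (2 * k)).
Proof.
move=> lesn x0; have := @qpoch_neg_pow n s lesn.
rewrite -(subnK lesn); move: (n - s)%N => m {n lesn}; rewrite addnK => E.
have hd i : 1 - q ^+ (2 * s).+1 * q ^+ i != 0 by rewrite exprS -mulrA -exprD.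
have hq2 i : 1 - q ^+ 2 * (q ^+ 2) ^+ i != 0 by rewrite -exprM -exprD exprS.
rewrite !left_sumE right_sumE //.
(* With X = x q^s, the argument of the second sum is d/X, as [phi_prod] requires. *)
rewrite (_ : q / x * q ^+ s = q ^+ (2 * s).+1 / (x * q ^+ s)); last first.
  rewrite exprS mul2n -addnn exprD; field.
  by rewrite expf_neq0.
rewrite mulrACA phi_prod ?qpoch_neg_pow_end ?phi_self //; last first.
- by rewrite mulf_neq0 // expf_neq0.
- by rewrite invr_eq0 expf_neq0.
have h1 : qpoch q q (2 * s) != 0 by apply: qpoch_neq0.
have h2 : qpoch (q ^+ 2) (q ^+ 2) m != 0 by apply: qpoch_neq0.
have h3 : qpoch (q ^+ 2) (q ^+ 2) (m + s + s) != 0 by apply: qpoch_neq0.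
have hs : q ^+ s != 0 by rewrite expf_neq0.
have hss : q ^+ (s * s) != 0 by rewrite expf_neq0.
have hmm : q ^+ (m * m) != 0 by rewrite expf_neq0.
have hms : q ^+ (2 * m * s) != 0 by rewrite expf_neq0.
set B := qpoch (q ^- (2 * (m + s))) _ _ in E *.
have {E} -> : B = (-1) ^+ s * q ^+ (s * s) * qpoch (q ^+ 2) (q ^+ 2) (m + s)
   / (qpoch (q ^+ 2) (q ^+ 2) m * q ^+ s * q ^+ (2 * (m + s) * s)).
  have h4 : q ^+ (2 * (m + s) * s) != 0 by rewrite expf_neq0.
  by rewrite -E; field; do ?[apply/andP; split].
rewrite (_ : (2 * (m + s) * s = 2 * m * s + s * s + s * s)%N); last by lia.
rewrite (_ : ((m + s) * (m + s) = m * m + 2 * m * s + s * s)%N); last by lia.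
rewrite !exprD -[(-1) ^+ s]signr_odd; case: (odd s); rewrite ?expr0 ?expr1.
  by field; do ?[apply/andP; split].
by field; do ?[apply/andP; split].
Qed.

End BaseQ.

(** * Specialization to the field of rational functions *)

Lemma qv_neq0 : qv != 0.
Proof. by rewrite tofrac_eq0 polyC_eq0 tofrac_eq0 polyX_eq0. Qed.

Lemma xv_neq0 : xv != 0.
Proof. by rewrite tofrac_eq0 polyX_eq0. Qed.

(** The indeterminate is not a root of unity: the polynomial X^(n+1) - 1 is nonzero, and both
    embeddings are injective. *)
Lemma one_sub_qv_exp n : 1 - qv * qv ^+ n != 0.
Proof.
rewrite -exprS -opprB oppr_eq0 /qv -!rmorphXn /= -(rmorph1 (@tofrac _)) -rmorphB.
rewrite tofrac_eq0 -polyC1 -polyCB polyC_eq0 -(rmorph1 (@tofrac _)) -rmorphB.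
by rewrite tofrac_eq0 -size_poly_eq0 size_XnsubC.
Qed.

Theorem theorem2p5 (n s : nat) (hsn : (s <= n)%N) :
  let q := qv in let x := xv in
  (\sum_(s <= k < n.+1)
     qpoch (q ^- (2 * n)) (q ^+ 2) k * qpoch x q k * q ^+ k
       / (qpoch q q (k - s) * qpoch q q (k + s)))
  * (\sum_(s <= k < n.+1)
     qpoch (q ^- (2 * n)) (q ^+ 2) k * qpoch (q / x) q k * q ^+ k
       / (qpoch q q (k - s) * qpoch q q (k + s)))
  =
  (-1) ^+ n * (qpoch (q ^+ 2) (q ^+ 2) n) ^+ 2 * q ^- (n * n)
    / (qpoch (q ^+ 2) (q ^+ 2) (n - s) * qpoch (q ^+ 2) (q ^+ 2) (n + s))
  * \sum_(s <= k < n.+1)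
      (-1) ^+ k * qpoch (q ^+ 2) (q ^+ 2) (n + k) * qpoch x q k
        * qpoch (q / x) q k * (q ^+ (k * k) * q ^- (2 * n * k))
      / (qpoch (q ^+ 2) (q ^+ 2) (n - k) * qpoch q q (k - s)
         * qpoch q q (k + s) * qpoch q q (2 * k)).
Proof.
exact: (@qpoch_sums_product _ qv qv_neq0 one_sub_qv_exp n s xv hsn xv_neq0).
Qed.
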